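(* Suppose $\sigma$ assigns to each $S\in\mathrm{Sp}(\mathbb{F}_2^{2n})$ a unitary operator $\sigma(S)$ on $L^2(\mathbb{F}_2^n)$ such that for every $x\in\mathbb{F}_2^{2n}$, $\sigma(S)W(x)\sigma(S)^*$ is a scalar multiple of $W(Sx)$. Then a unitary operator $M$ on $L^2(\mathbb{F}_2^n)$ belongs to $\mathrm{Iso}_{U^3}(\mathbb{F}_2^n)$ if and only if $M=\alpha\,\sigma(S)W(v)$ for some $\alpha\in\mathbb{C}$ with $|\alpha|=1$, some $S\in\mathrm{Sp}(\mathbb{F}_2^{2n})$ and some $v\in\mathbb{F}_2^{2n}$. Moreover, $\mathrm{Iso}_{U^3}(\mathbb{F}_2^n)/\big(\mathrm{U}(1)\cdot\mathrm{HW}(\mathbb{F}_2^{2n})\big)\cong\mathrm{Sp}(\mathbb{F}_2^{2n})$ as groups.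
   Context: $L^2(\mathbb{F}_2^n)$ is the space of functions $\mathbb{F}_2^n\to\mathbb{C}$ with inner product $\langle f,g\rangle=\mathbb{E}_xf(x)\overline{g(x)}$; $A^*$ is the adjoint. For $x\in\mathbb{F}_2$, $|x|\in\{0,1\}\subset\mathbb{Z}$; for vectors $|v|=\sum|v_i|$, $a\circ b$ is the entrywise product. The Weyl operator $W(a,b)$, $(a,b)\in\mathbb{F}_2^n\times\mathbb{F}_2^n=\mathbb{F}_2^{2n}$, acts by $(W(a,b)f)(x)=(-i)^{|a\circ b|}(-1)^{b\cdot x}f(x+a)$. $\mathrm{HW}(\mathbb{F}_2^{2n})$ is the group generated by all Weyl operators, $\mathrm{U}(1)$ is the group of scalar unitaries $\alpha I$ with $|\alpha|=1$, and $\mathrm{U}(1)\cdot\mathrm{HW}(\mathbb{F}_2^{2n})$ is the group of products $\alpha W$ with $|\alpha|=1$, $W\in\mathrm{HW}(\mathbb{F}_2^{2n})$. $\mathrm{Sp}(\mathbb{F}_2^{2n})$ is the group of invertible linear maps of $\mathbb{F}_2^{2n}$ preserving the symplectic form $[(a,b),(c,d)]=a\cdot d+b\cdot c$. The Gowers norm is $\|f\|_{U^3}=(\mathbb{E}_{x,a,b,c}\Delta_a\Delta_b\Delta_cf(x))^{1/8}$ with $\Delta_af(x)=f(x+a)\overline{f(x)}$. $\mathrm{Iso}_{U^3}(\mathbb{F}_2^n)$ is the group of unitary operators $M$ on $L^2(\mathbb{F}_2^n)$ with $\|Mf\|_{U^3}=\|f\|_{U^3}$ for all $f$. *)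

(* Defs.v *)
From HB Require Import structures.
From mathcomp Require Import all_boot all_order all_algebra all_field.
From mathcomp Require Import complex reals.
Set Implicit Arguments. Unset Strict Implicit. Unset Printing Implicit Defensive.
Import Order.TTheory GRing.Theory Num.Theory.
Local Open Scope ring_scope.

Section Defs.
Variables (R : realType) (n : nat).

Local Notation Cx := R[i].
Local Notation Vn := 'rV['F_2]_n.
Local Notation V2n := (Vn * Vn)%type.
Local Notation L2 := {ffun Vn -> Cx}.

Definition absF2 (x : 'F_2) : nat := if x == 0 then 0%N else 1%N.
Definition absV (v : Vn) : nat := (\sum_(j < n) absF2 (v ord0 j))%N.
Definition hadamard (a b : Vn) : Vn := \row_(j < n) (a ord0 j * b ord0 j).
Definition dotF2 (a b : Vn) : 'F_2 := \sum_(j < n) a ord0 j * b ord0 j.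

Definition sympl (x y : V2n) : 'F_2 := dotF2 x.1 y.2 + dotF2 x.2 y.1.

Definition linearV2n (S : V2n -> V2n) : Prop :=
  forall (k : 'F_2) (x y : V2n),
    S (k *: x.1 + y.1, k *: x.2 + y.2) = (k *: (S x).1 + (S y).1, k *: (S x).2 + (S y).2).

Definition Sp (S : V2n -> V2n) : Prop :=
  linearV2n S /\ bijective S /\ forall x y, sympl (S x) (S y) = sympl x y.

Definition inner (f g : L2) : Cx :=
  (#|{: Vn}|%:R)^-1 * \sum_(x : Vn) f x * (g x)^*.

Definition Weyl (v : V2n) (f : L2) : L2 :=
  [ffun x : Vn => (- 'i) ^+ (absV (hadamard v.1 v.2))
                  * (-1) ^+ (absF2 (dotF2 v.2 x)) * f (x + v.1)].

Definition delta (y : Vn) : L2 := [ffun x => if x == y then 1 else 0].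

(* adjoint A^* of a (linear) operator A, characterised by <A f, g> = <f, A^* g>;
   on the standard basis: (A^* g)(y) = |F_2^n| * conj <A delta_y, g>. *)
Definition adjoint (A : L2 -> L2) (g : L2) : L2 :=
  [ffun y => #|{: Vn}|%:R * (inner (A (delta y)) g)^*].

Definition unitary (A : L2 -> L2) : Prop :=
  linear A /\ (forall f, adjoint A (A f) = f) /\ (forall f, A (adjoint A f) = f).

Definition Delta (a : Vn) (f : L2) : L2 := [ffun x => f (x + a) * (f x)^*].
Definition U3norm (f : L2) : Cx :=
  8.-root ((#|{: Vn}|%:R ^+ 4)^-1 *
     \sum_(x : Vn) \sum_(a : Vn) \sum_(b : Vn) \sum_(c : Vn)
        Delta a (Delta b (Delta c f)) x).

Definition IsoU3 (M : L2 -> L2) : Prop :=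
  unitary M /\ forall f, U3norm (M f) = U3norm f.

Inductive HW : (L2 -> L2) -> Prop :=
  | HW_Weyl v : HW (Weyl v)
  | HW_id : HW id
  | HW_comp M N : HW M -> HW N -> HW (M \o N)
  | HW_inv M N : HW M -> (forall f, M (N f) = f) -> (forall f, N (M f) = f) -> HW N.

Definition U1HW (M : L2 -> L2) : Prop :=
  exists (alpha : Cx) (W : L2 -> L2), `|alpha| = 1 /\ HW W /\ M = (fun f => alpha *: W f).

End Defs.

Notation Cx R := (R[i]) (only parsing).
Notation Vn n := ('rV['F_2]_n) (only parsing).
Notation V2n n := (('rV['F_2]_n * 'rV['F_2]_n)%type) (only parsing).
Notation L2 R n := ({ffun 'rV['F_2]_n -> R[i]}) (only parsing).

(* Main.v *)
Require Import Defs.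
From HB Require Import structures.
From mathcomp Require Import all_boot all_order all_algebra all_field.
From mathcomp Require Import complex reals boolp ring.
Import Order.TTheory GRing.Theory Num.Theory.
Local Open Scope ring_scope.
Set Implicit Arguments. Unset Strict Implicit. Unset Printing Implicit Defensive.

(** Up to normalisation, ||f||_{U^3}^8 is F(f, conj f), where F(f, h) is the sum
    over all v of (sum_x (W(v) f)(x) h(x))^4, a quartic form in each variable
    which is invariant under f |-> W(v) f.  If M is an isometry, the identity
    F(Mf, conj Mf) = F(f, conj f) remains true with f and conj f replaced by
    independent variables; hence A = M W(v) M^-1 satisfies F(Af, h) = F(f, h).
    Polarising in h, A preserves every parallelogram form
    sum_p f(p) f(p+x) f(p+y) f(p+x+y).  For x = y = 0 this is the Fermat quartic,
    whose linear symmetries are monomial; x = 0 forces the underlying permutation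
    to be a translation, and general x, y force the coefficients to be a
    character up to a scalar.  So A is a multiple of a Weyl operator W(Sv), and
    the commutation relations make S symplectic.  Conversely, an operator that
    permutes the Weyl operators by conjugation only permutes the terms of F. *)

(** * Polynomial functions and polarisation *)

Section Polynomials.
Variable C : numFieldType.

Lemma nat_roots_eq0 (p : {poly C}) : (forall k : nat, p.[k%:R] = 0) -> p = 0.
Proof.
move=> p0; apply: (@roots_geq_poly_eq0 _ p [seq k%:R | k <- iota 0 (size p)]).
- by apply/allP => x /mapP[k _ ->]; rewrite rootE p0.
- by rewrite map_inj_uniq ?iota_uniq // => a b /eqP; rewrite eqr_nat => /eqP.
- by rewrite size_map size_iota.
Qed.

Definition polyfun (f : C -> C) := exists p : {poly C}, forall x, f x = p.[x].

Lemma polyfun_eq0 (f : C -> C) :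
  polyfun f -> (forall k : nat, f k%:R = 0) -> forall x, f x = 0.
Proof.
by case=> p fp f0 x; rewrite fp (@nat_roots_eq0 p) ?horner0 // => k; rewrite -fp.
Qed.

Lemma polyfun_cst (c : C) : polyfun (fun=> c).
Proof. by exists c%:P => x; rewrite hornerC. Qed.

Lemma polyfun_id : polyfun id.
Proof. by exists 'X => x; rewrite hornerX. Qed.

Lemma polyfunD (f g : C -> C) :
  polyfun f -> polyfun g -> polyfun (fun x => f x + g x).
Proof. by case=> p fp [q gq]; exists (p + q) => x; rewrite hornerD fp gq. Qed.

Lemma polyfunM (f g : C -> C) :
  polyfun f -> polyfun g -> polyfun (fun x => f x * g x).
Proof. by case=> p fp [q gq]; exists (p * q) => x; rewrite hornerM fp gq. Qed.

Lemma polyfunX (f : C -> C) k : polyfun f -> polyfun (fun x => f x ^+ k).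
Proof. by case=> p fp; exists (p ^+ k) => x; rewrite horner_exp fp. Qed.

Lemma polyfun_sum (I : finType) (F : I -> C -> C) :
  (forall i, polyfun (F i)) -> polyfun (fun x => \sum_i F i x).
Proof.
move=> /(_ _)/cid FP; exists (\sum_i sval (FP i)) => x.
by rewrite horner_sum; apply: eq_bigr => i _; case: (FP i).
Qed.

(** The variables are freed one at a time: a polynomial in one variable that vanishes at all
    naturals has too many roots. *)
Lemma polyfun4_eq0 (f : C -> C -> C -> C -> C) :
  (forall b c d, polyfun (fun a => f a b c d)) ->
  (forall a c d, polyfun (fun b => f a b c d)) ->
  (forall a b d, polyfun (fun c => f a b c d)) ->
  (forall a b c, polyfun (f a b c)) ->
  (forall i j k l : nat, f i%:R j%:R k%:R l%:R = 0) ->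
  forall a b c d, f a b c d = 0.
Proof.
move=> pa pb pc pd f0 a b c d.
apply: (polyfun_eq0 (pa b c d)) => i; apply: (polyfun_eq0 (pb _ c d)) => j.
by apply: (polyfun_eq0 (pc _ _ d)) => k; apply: (polyfun_eq0 (pd _ _ _)) => l.
Qed.

(* The sum over signs of [e2 e3 e4 (x + e2 y + e3 z + e4 w)^4] is [192 x y z w]. *)
Lemma polarization4 (V : zmodType) (I J : finType) (L : I -> V -> C)
    (K : J -> V -> C) :
  (forall i, {morph L i : x y / x - y}) -> (forall j, {morph K j : x y / x - y}) ->
  (forall x, \sum_i L i x ^+ 4 = \sum_j K j x ^+ 4) ->
  forall x y z w, \sum_i L i x * L i y * L i z * L i w =
                  \sum_j K j x * K j y * K j z * K j w.
Proof.
(* Sums appear as [x - - y] because additivity is given through subtraction. *)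
have expand (I' : finType) (L' : I' -> V -> C) x y z w :
    (forall i, {morph L' i : x y / x - y}) ->
    192 * \sum_i L' i x * L' i y * L' i z * L' i w =
    let q u := \sum_i L' i u ^+ 4 in
    q (x - - y - - z - - w) - q (x - y - - z - - w) - q (x - - y - z - - w)
    - q (x - - y - - z - w) + q (x - - y - z - w) + q (x - y - - z - w)
    + q (x - y - z - - w) - q (x - y - z - w).
  move=> LB /=.
  have LN i u : L' i (- u) = - L' i u.
    by rewrite -[X in L' i X]sub0r LB -{1}(subrr 0) LB subrr sub0r.
  rewrite mulr_sumr -!sumrN -!big_split /=; apply: eq_bigr => i _.
  rewrite !LB !LN; ring.
move=> LB KB LK x y z w.
apply: (@mulfI _ 192); first by rewrite pnatr_eq0.
by rewrite !expand //= !LK.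
Qed.

End Polynomials.

Lemma F2_cases (s : 'F_2) : s = 0 \/ s = 1.
Proof. by case: s => [[|[|k]] p] //; [left|right]; apply/val_inj. Qed.

Ltac char2 := apply/rowP; let j := fresh "j" in intro j; rewrite !mxE;
  repeat match goal with |- context [fun_of_matrix ?x _ j] =>
    case: (F2_cases (x ord0 j)) => -> end; by apply/val_inj.

(** * Signs, characters and the algebra of Weyl operators *)

Section Weyl.
Variables (R : realType) (n : nat).
Local Notation C := R[i].
Local Notation V := 'rV['F_2]_n.
Local Notation VV := (V * V)%type.
Local Notation L2 := {ffun V -> C}.
Implicit Types (x y z a b : V) (u v w : VV) (f g h : L2).

Lemma addVV x : x + x = 0.
Proof. by apply/rowP => j; rewrite !mxE; case: (F2_cases (x ord0 j)) => ->; apply/val_inj. Qed.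

Lemma addVK y x : x + y + y = x.
Proof. by rewrite -addrA addVV addr0. Qed.

Lemma oppV x : - x = x.
Proof. by apply/eqP; rewrite eq_sym -addr_eq0 addVV. Qed.

Lemma sum_shift (a : V) (F : V -> C) : \sum_x F (x + a) = \sum_x F x.
Proof.
by rewrite [RHS](reindex_inj (@addIr _ a)).
Qed.

Lemma dotDr a x y : dotF2 a (x + y) = dotF2 a x + dotF2 a y.
Proof.
by rewrite /dotF2 -big_split; apply: eq_bigr => j _; rewrite !mxE mulrDr.
Qed.

Lemma dotC x y : dotF2 x y = dotF2 y x.
Proof. by apply: eq_bigr => j _; rewrite mulrC. Qed.

Lemma dotDl a x y : dotF2 (x + y) a = dotF2 x a + dotF2 y a.
Proof. by rewrite dotC dotDr !(dotC a). Qed.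

Lemma dot0r a : dotF2 a 0 = 0.
Proof. by rewrite /dotF2 big1 // => j _; rewrite mxE mulr0. Qed.

Lemma dot_unit a j : dotF2 a (delta_mx ord0 j) = a ord0 j.
Proof.
rewrite /dotF2 (bigD1 j) //= big1 => [|k kj]; last first.
  by rewrite mxE (negbTE kj) andbF mulr0.
by rewrite mxE !eqxx mulr1 addr0.
Qed.

Definition sgnF2 (t : 'F_2) : C := (-1) ^+ absF2 t.

Lemma sgnD s t : sgnF2 (s + t) = sgnF2 s * sgnF2 t.
Proof.
rewrite /sgnF2; case: (F2_cases s) => ->; case: (F2_cases t) => ->;
  rewrite /absF2 /= ?expr0 ?expr1; ring.
Qed.

Lemma sgn0 : sgnF2 0 = 1.
Proof. by rewrite /sgnF2 /absF2 eqxx. Qed.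

Lemma sgn1 : sgnF2 1 = -1.
Proof. by rewrite /sgnF2 /absF2 /= expr1. Qed.

Lemma sgn_sqr t : sgnF2 t * sgnF2 t = 1.
Proof. by rewrite -expr2 /sgnF2 sqrr_sign. Qed.

Lemma sgn_neq0 t : sgnF2 t != 0.
Proof. by rewrite /sgnF2 signr_eq0. Qed.

Lemma sgn_conj t : (sgnF2 t)^* = sgnF2 t.
Proof. by rewrite /sgnF2 rmorphXn rmorphN rmorph1. Qed.

Lemma sgn_inj : injective sgnF2.
Proof.
move=> s t; case: (F2_cases s) => ->; case: (F2_cases t) => -> //;
  rewrite sgn0 sgn1 => /eqP.
  by rewrite -subr_eq0 opprK -(natrD _ 1 1) pnatr_eq0.
by rewrite eq_sym -subr_eq0 opprK -(natrD _ 1 1) pnatr_eq0.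
Qed.

(** Orthogonality of characters: if coordinate [j] of [x] is 1, shifting [a] by the [j]-th unit
    vector flips every sign, so the sum equals its own negative. *)
Lemma sgn_sum x : \sum_a sgnF2 (dotF2 a x) = #|{: V}|%:R * (x == 0)%:R.
Proof.
have [->|/eqP x0] := eqVneq x 0.
  under eq_bigr do rewrite dot0r sgn0.
  by rewrite sumr_const mulr1.
have [j xj] : exists j, x ord0 j = 1.
  apply: contrapT => nx; apply: x0; apply/rowP => j; rewrite mxE.
  by case: (F2_cases (x ord0 j)) => // xj; case: nx; exists j.
rewrite mulr0; set S := \sum_a _.
have : S = - S.
  rewrite {1}/S -(sum_shift (delta_mx ord0 j)) -sumrN.
  apply: eq_bigr => a _; rewrite dotDl sgnD (dotC (delta_mx _ _)) dot_unit xj sgn1; ring.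
by move/eqP; rewrite -subr_eq0 opprK -mulr2n mulrn_eq0 => /eqP.
Qed.

(** A sign-valued character is determined on the unit vectors; [b] marks those sent to -1. *)
Lemma character_sgn (s : V -> C) :
  (forall x, s x ^+ 2 = 1) -> (forall x y, s (x + y) = s x * s y) ->
  exists b, forall x, s x = sgnF2 (dotF2 b x).
Proof.
move=> s2 sM.
pose b : V := \row_j (s (delta_mx ord0 j) != 1)%:R; exists b.
have s0 : s 0 = 1.
  by have := s2 0; rewrite expr2 -sM addr0.
have sb j : s (delta_mx ord0 j) = sgnF2 (b ord0 j).
  rewrite mxE; case: eqP => [->|/eqP s1]; first by rewrite sgn0.
  have /eqP := s2 (delta_mx ord0 j).
  by rewrite sqrf_eq1 (negbTE s1) /= => /eqP ->; rewrite sgn1.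
have sum_ind (I : Type) (r : seq I) (F : I -> V) :
    (forall i, s (F i) = sgnF2 (dotF2 b (F i))) ->
    s (\sum_(i <- r) F i) = sgnF2 (dotF2 b (\sum_(i <- r) F i)).
  move=> sF; elim/big_rec: _ => [|i x _ IH]; first by rewrite s0 dot0r sgn0.
  by rewrite sM dotDr sgnD sF IH.
move=> x; rewrite (row_sum_delta x); apply: sum_ind => j.
case: (F2_cases (x ord0 j)) => ->; first by rewrite scale0r s0 dot0r sgn0.
by rewrite scale1r sb dot_unit.
Qed.

Definition phase (v : VV) : C := (- 'i) ^+ absV (hadamard v.1 v.2).

Lemma WeylE v f x :
  Weyl v f x = phase v * sgnF2 (dotF2 v.2 x) * f (x + v.1).
Proof. by rewrite ffunE. Qed.

Lemma phase4 v : phase v ^+ 4 = 1.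
Proof.
by rewrite /phase exprAC (exprM _ 2 2) sqrrN sqrCi sqrrN !expr1n.
Qed.

Lemma phase_neq0 v : phase v != 0.
Proof. by rewrite expf_neq0 // oppr_eq0 neq0Ci. Qed.

Lemma norm_phase v : `|phase v| = 1.
Proof. by rewrite normrX normrN normCi expr1n. Qed.

(** Squaring turns [- 'i] into -1, and then only the parity of the integer weight matters. This
    makes each Weyl operator an involution. *)
Lemma phase_sqr v : phase v * phase v = sgnF2 (dotF2 v.2 v.1).
Proof.
rewrite dotC -expr2 /phase exprAC sqrrN sqrCi /absV /dotF2.
elim/big_rec2: _ => [|j t k _ IH]; first by rewrite sgn0.
by rewrite exprD mxE {}IH sgnD.
Qed.

Lemma WeylK v f : Weyl v (Weyl v f) = f.
Proof.
apply/ffunP => x; rewrite !WeylE addVK dotDr sgnD.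
transitivity ((phase v * phase v) * (sgnF2 (dotF2 v.2 x) * sgnF2 (dotF2 v.2 x)) *
   sgnF2 (dotF2 v.2 v.1) * f x); first ring.
by rewrite phase_sqr sgn_sqr mulr1 sgn_sqr mul1r.
Qed.

Definition cocycle v w : C :=
  phase v * phase w / phase (v + w) * sgnF2 (dotF2 w.2 v.1).

Lemma Weyl_mul v w f : Weyl v (Weyl w f) = cocycle v w *: Weyl (v + w) f.
Proof.
apply/ffunP => x; rewrite [RHS]ffunE !WeylE /cocycle /= dotDr dotDl !sgnD addrA.
rewrite /GRing.scale /=; field; exact: phase_neq0.
Qed.

Lemma cocycle_neq0 v w : cocycle v w != 0.
Proof. by rewrite !mulf_neq0 ?invr_eq0 ?phase_neq0 ?sgn_neq0. Qed.

Lemma norm_cocycle v w : `|cocycle v w| = 1.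
Proof.
by rewrite !normrM normfV !norm_phase normrX normrN normr1 expr1n invr1 !mulr1.
Qed.

(** Hence the fourth powers in F do not see the scalars arising from composing Weyl operators. *)
Lemma cocycle4 v w : cocycle v w ^+ 4 = 1.
Proof.
rewrite /cocycle !exprMn exprVn !phase4 invr1 !mul1r (exprM _ 2 2) [sgnF2 _ ^+ 2]expr2.
by rewrite sgn_sqr expr1n.
Qed.

Lemma Weyl_comm v w f :
  Weyl v (Weyl w f) = sgnF2 (sympl v w) *: Weyl w (Weyl v f).
Proof.
apply/ffunP => x; rewrite [RHS]ffunE !WeylE !dotDr /sympl !sgnD (addrAC x).
rewrite (dotC v.1 w.2) /GRing.scale /=.
have := sgn_sqr (dotF2 v.2 w.1).
move: (sgnF2 _) => s1 E; rewrite -[LHS]mul1r -[in LHS]E; ring.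
Qed.
End Weyl.

(** * The bilinear pairing, unitaries, and the quartic form F *)

Section Quartic.
Variables (R : realType) (n : nat).
Local Notation C := R[i].
Local Notation V := 'rV['F_2]_n.
Local Notation VV := (V * V)%type.
Local Notation L2 := {ffun V -> C}.
Implicit Types (x y z a b : V) (u v w : VV) (f g h : L2) (A M N : L2 -> L2).

(** Bilinear rather than sesquilinear, so that F is polynomial in both arguments; [bil f (conjf g)]
    is the unnormalised inner product. *)
Definition bil f h : C := \sum_x f x * h x.

Definition conjf f : L2 := [ffun x => (f x)^*].

Lemma conjfK : involutive conjf.
Proof. by move=> f; apply/ffunP => x; rewrite !ffunE conjCK. Qed.

Lemma ffun_scaleE (c : C) f x : (c *: f) x = c * f x.
Proof. by rewrite ffunE. Qed.

Lemma conjf_lin (c : C) f g : conjf (c *: f + g) = c^* *: conjf f + conjf g.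
Proof.
by apply/ffunP => x; rewrite !ffunE /= rmorphD rmorphM.
Qed.

Lemma conjfZ (c : C) f : conjf (c *: f) = c^* *: conjf f.
Proof. by apply/ffunP => x; rewrite !ffunE /= rmorphM. Qed.

Lemma bilDl (c : C) f g h : bil (c *: f + g) h = c * bil f h + bil g h.
Proof.
rewrite /bil mulr_sumr -big_split; apply: eq_bigr => x _ /=.
by rewrite !ffunE /= mulrDl mulrA.
Qed.

Lemma bilC f h : bil f h = bil h f.
Proof. by apply: eq_bigr => x _; rewrite mulrC. Qed.

Lemma bilDr (c : C) f g h : bil h (c *: f + g) = c * bil h f + bil h g.
Proof. by rewrite bilC bilDl !(bilC h). Qed.

Lemma bilZl (c : C) f h : bil (c *: f) h = c * bil f h.
Proof.
by rewrite /bil mulr_sumr; apply: eq_bigr => x _; rewrite ffun_scaleE mulrA.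
Qed.

Lemma bilBr h : {morph bil h : f g / f - g}.
Proof.
move=> f g; rewrite /bil -sumrB; apply: eq_bigr => x _.
by rewrite !ffunE mulrBr.
Qed.

Lemma deltaE y x : (delta R y : L2) x = (x == y)%:R.
Proof. by rewrite ffunE; case: eqP. Qed.

Lemma bil_delta f y : bil f (delta R y) = f y.
Proof.
rewrite /bil (bigD1 y) //= deltaE eqxx mulr1 big1 ?addr0 // => x /negbTE xy.
by rewrite deltaE xy mulr0.
Qed.

Lemma conj_delta y : conjf (delta R y) = delta R y.
Proof. by apply/ffunP => x; rewrite ffunE deltaE rmorph_nat. Qed.

Lemma ffun_delta f : f = \sum_y f y *: delta R y.
Proof.
apply/ffunP => x; rewrite sum_ffunE (bigD1 x) //= big1 => [|y /negbTE yx].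
  by rewrite addr0 ffun_scaleE deltaE eqxx mulr1.
by rewrite ffun_scaleE deltaE eq_sym yx mulr0.
Qed.

Lemma operator0 A : linear A -> A 0 = 0.
Proof. by move=> Al; have := Al (-1) 0 0; rewrite scaler0 addr0 scaleN1r addNr. Qed.

Lemma operatorZ A : linear A -> forall c f, A (c *: f) = c *: A f.
Proof. by move=> Al c f; rewrite -[_ *: f]addr0 Al operator0 // addr0. Qed.

Lemma operatorB A : linear A -> {morph A : f g / f - g}.
Proof.
by move=> Al f g; rewrite addrC -scaleN1r Al scaleN1r addrC.
Qed.

Lemma operatorE A : linear A -> forall f x, A f x = \sum_y f y * A (delta R y) x.
Proof.
move=> Al f x; rewrite {1}(ffun_delta f).
have -> (r : seq V) : A (\sum_(y <- r) f y *: delta R y)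
    = \sum_(y <- r) f y *: A (delta R y).
  elim: r => [|y r IH]; first by rewrite !big_nil operator0.
  by rewrite !big_cons Al IH.
by rewrite sum_ffunE; apply: eq_bigr => y _; rewrite ffun_scaleE.
Qed.

Lemma linear_comp A M : linear A -> linear M -> linear (A \o M).
Proof. by move=> Al Ml c f g /=; rewrite Ml Al. Qed.

Lemma Weyl_linear v : linear (@Weyl R n v).
Proof.
move=> c f g; apply/ffunP => x.
rewrite !(WeylE, ffunE) /GRing.scale /=; ring.
Qed.

Lemma card_neq0 : #|{: V}|%:R != 0 :> C.
Proof. by rewrite pnatr_eq0 -lt0n; apply/card_gt0P; exists 0. Qed.

Lemma adjointE A g y : adjoint A g y = bil (conjf (A (delta R y))) g.
Proof.
rewrite ffunE /inner rmorphM fmorphV rmorph_nat mulVKf ?card_neq0 //.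
rewrite rmorph_sum; apply: eq_bigr => x _.
by rewrite rmorphM /= conjCK [in RHS]ffunE.
Qed.

Lemma adjointP A f g : linear A ->
  bil (A f) (conjf g) = bil f (conjf (adjoint A g)).
Proof.
move=> Al; rewrite /bil.
under eq_bigr do rewrite operatorE // mulr_suml.
rewrite exchange_big; apply: eq_bigr => y _ /=.
rewrite ffunE adjointE rmorph_sum mulr_sumr; apply: eq_bigr => x _.
by rewrite !ffunE rmorphM /= conjCK mulrA.
Qed.

Lemma unitary_bil A f g : unitary A ->
  bil (A f) (conjf (A g)) = bil f (conjf g).
Proof. by case=> Al [AK _]; rewrite adjointP // AK. Qed.

(** Preserving the pairing makes the adjoint a left inverse; it then agrees with the right inverse
    [B] and is two-sided. *)
Lemma unitary_of_bil A B : linear A -> (forall f, A (B f) = f) ->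
  (forall f g, bil (A f) (conjf (A g)) = bil f (conjf g)) -> unitary A.
Proof.
move=> Al AB AD.
have AK f : adjoint A (A f) = f.
  by apply/ffunP => y; rewrite adjointE bilC AD conj_delta bil_delta.
by split=> //; split=> // f; rewrite -{1}(AB f) AK AB.
Qed.

Lemma unitary_comp A M : unitary A -> unitary M -> unitary (A \o M).
Proof.
move=> uA uM; apply: (@unitary_of_bil _ (adjoint M \o adjoint A)).
- by apply: linear_comp; [case: uA|case: uM].
- by move=> f /=; case: uM => _ [_ ->]; case: uA => _ [_ ->].
- by move=> f g /=; rewrite unitary_bil // unitary_bil.
Qed.

Lemma unitary_adjoint A : unitary A -> unitary (adjoint A).
Proof.
move=> uA; apply: (@unitary_of_bil _ A).
- move=> c f g; apply/ffunP => y.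
  by rewrite adjointE bilDr -!adjointE !ffunE.
- by case: uA => _ [AK _] f.
- move=> f g; rewrite -[in RHS](proj2 (proj2 uA) f) -[in RHS](proj2 (proj2 uA) g).
  by rewrite (@unitary_bil A).
Qed.

Lemma unitary_Weyl (c : C) v : `|c| = 1 -> unitary (fun f => c *: Weyl v f).
Proof.
move=> c1.
have c0 : c != 0 by rewrite -normr_eq0 c1 oner_eq0.
apply: (@unitary_of_bil _ (fun f => c^-1 *: Weyl v f)).
- by move=> d f g; rewrite Weyl_linear scalerDr !scalerA (mulrC c).
- move=> f; rewrite (operatorZ (@Weyl_linear v)) WeylK scalerA mulfV //.
  by rewrite scale1r.
- move=> f g; rewrite /bil -[RHS](sum_shift v.1); apply: eq_bigr => x _.
  rewrite !(WeylE, ffunE) /GRing.scale /= !rmorphM /= sgn_conj.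
  have cc : c * c^* = 1 by rewrite -normCK c1 expr1n.
  have pp : phase R v * (phase R v)^* = 1 by rewrite -normCK norm_phase expr1n.
  transitivity ((c * c^*) * (phase R v * (phase R v)^*) *
    (sgnF2 R (dotF2 v.2 x) * sgnF2 R (dotF2 v.2 x)) *
    (f (x + v.1) * (g (x + v.1))^*)); first ring.
  by rewrite cc pp sgn_sqr !mul1r.
Qed.

Definition quartic f h : C := \sum_v bil (Weyl v f) h ^+ 4.

Lemma quartic_Weyl v f h : quartic (Weyl v f) h = quartic f h.
Proof.
rewrite /quartic [RHS](reindex_inj (@addIr _ v)); apply: eq_bigr => w _ /=.
by rewrite Weyl_mul bilZl exprMn cocycle4 mul1r.
Qed.

(** Expand the fourth power; summing over [a] leaves only the quadruples with sum zero. *)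
Lemma fourier4 (F : V -> C) :
  \sum_a (\sum_x sgnF2 R (dotF2 a x) * F x) ^+ 4 =
  #|{: V}|%:R * \sum_x \sum_y \sum_z F x * F y * F z * F (x + y + z).
Proof.
have exp4 a : (\sum_x sgnF2 R (dotF2 a x) * F x) ^+ 4 =
    \sum_x \sum_y \sum_z \sum_t
      sgnF2 R (dotF2 a (x + y + z + t)) * (F x * F y * F z * F t).
  rewrite (exprS _ 3) mulr_suml; apply: eq_bigr => x _.
  rewrite (exprS _ 2) mulr_suml mulr_sumr; apply: eq_bigr => y _.
  rewrite expr2 mulr_suml !mulr_sumr; apply: eq_bigr => z _.
  rewrite !mulr_sumr; apply: eq_bigr => t _.
  rewrite !dotDr !sgnD; ring.
under eq_bigr do rewrite exp4.
rewrite exchange_big mulr_sumr; apply: eq_bigr => x _.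
rewrite exchange_big mulr_sumr; apply: eq_bigr => y _.
rewrite exchange_big mulr_sumr; apply: eq_bigr => z _.
rewrite exchange_big /=.
under eq_bigr do rewrite -mulr_suml sgn_sum.
rewrite (bigD1 (x + y + z)) //= big1 => [|t txyz].
  by rewrite addr0 addVV eqxx mulr1.
by rewrite addr_eq0 oppV eq_sym (negbTE txyz) mulr0 mul0r.
Qed.

(** For fixed [a], the pairings are Fourier coefficients of [f (x + a) * h x], up to a phase of
    fourth power 1. *)
Lemma quarticE f h : quartic f h = #|{: V}|%:R * \sum_a \sum_x \sum_y \sum_z
  (f (x + a) * h x) * (f (y + a) * h y) * (f (z + a) * h z) *
  (f (x + y + z + a) * h (x + y + z)).
Proof.
rewrite mulr_sumr /quartic.
transitivity (\sum_a \sum_b bil (Weyl (a, b) f) h ^+ 4).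
  by rewrite pair_bigA; apply: eq_bigr => -[].
apply: eq_bigr => a _; rewrite -(fourier4 (fun x => f (x + a) * h x)).
apply: eq_bigr => b _; rewrite -[RHS]mul1r -(phase4 R (a, b)) -exprMn mulr_sumr.
congr (_ ^+ 4); apply: eq_bigr => x _; rewrite WeylE /=; ring.
Qed.

(** The even vertices of a cube spanned by a, b, c sum to zero and carry the conjugates; the odd
    vertices are their translates by a + b + c. This is the pattern of [quarticE]. *)
Lemma U3sum_quartic f :
  #|{: V}|%:R * \sum_x \sum_a \sum_b \sum_c Delta a (Delta b (Delta c f)) x =
  quartic f (conjf f).
Proof.
rewrite quarticE; congr (_ * _).
rewrite [RHS]exchange_big; apply: eq_bigr => x _ /=.
(* Substitute c = p + a + b, then a = y + x + b, then b = z + x + p. *)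
transitivity (\sum_p \sum_b \sum_a Delta a (Delta b (Delta (p + (a + b)) f)) x).
  rewrite [RHS]exchange_big /=.
  rewrite [LHS]exchange_big /=.
  apply: eq_bigr => b _; rewrite [RHS]exchange_big; apply: eq_bigr => a _ /=.
  by rewrite (sum_shift (a + b) (fun c => Delta a (Delta b (Delta c f)) x)).
apply: eq_bigr => p _.
transitivity (\sum_b \sum_y
   Delta (y + (x + b)) (Delta b (Delta (p + (y + (x + b) + b)) f)) x).
  apply: eq_bigr => b _.
  by rewrite (sum_shift (x + b) (fun a => Delta a (Delta b (Delta (p + (a + b)) f)) x)).
rewrite exchange_big; apply: eq_bigr => y _ /=.
rewrite -(sum_shift (x + p)); apply: eq_bigr => z _.
rewrite !ffunE !rmorphM /= !conjCK.
rewrite (_ : p + (y + (x + (z + (x + p))) + (z + (x + p))) = y + x + p); last by char2.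
rewrite (_ : x + (y + (x + (z + (x + p)))) = y + z + p + x); last by char2.
rewrite (_ : y + z + p + x + (z + (x + p)) = y); last by char2.
rewrite (_ : y + z + p + x + (y + x + p) = z); last by char2.
rewrite (_ : x + (z + (x + p)) = z + p); last by char2.
rewrite (_ : y + (y + x + p) = x + p); last by char2.
rewrite (_ : z + p + (y + x + p) = x + y + z); last by char2.
rewrite (_ : x + (y + x + p) = y + p); last by char2.
rewrite (_ : y + z + p + x = x + y + z + p); last by char2.
ring.
Qed.

(** The eighth power inverts [8.-root] at every complex number, so the norm determines the sum. *)
Lemma U3norm_eq f g :
  (U3norm f = U3norm g) <-> (quartic f (conjf f) = quartic g (conjf g)).
Proof.
rewrite -!U3sum_quartic /U3norm; split=> [/(congr1 (fun t => t ^+ 8))|].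
  rewrite !rootCK // => /mulfI -> //.
  by rewrite invr_eq0 expf_neq0 // card_neq0.
by move/(mulfI card_neq0) => ->.
Qed.

Lemma quartic_lin (a b c d : C) f g h k :
  quartic (a *: f + b *: g) (c *: h + d *: k) =
  \sum_v (a * (c * bil (Weyl v f) h + d * bil (Weyl v f) k) +
          b * (c * bil (Weyl v g) h + d * bil (Weyl v g) k)) ^+ 4.
Proof.
apply: eq_bigr => v _; congr (_ ^+ 4).
rewrite Weyl_linear (operatorZ (@Weyl_linear v)) bilDl bilZl.
by rewrite !bilDr -!(bilC (d *: k)) !bilZl !(bilC k).
Qed.

(* A polynomial in f and its conjugate that vanishes identically vanishes as a
   polynomial in two independent variables: with real s, t the pair
   ((s + it) f, (s - it) conj f) is the restriction of a polynomial map. *)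
Lemma quartic_conj_indep M : linear M ->
  (forall f, quartic (M f) (conjf (M f)) = quartic f (conjf f)) ->
  forall f h, quartic (M f) (conjf (M (conjf h))) = quartic f h.
Proof.
move=> Ml MU f h; set g := conjf h.
pose E (a a' b b' : C) :=
  quartic ((a + 'i * a') *: M f + (b + 'i * b') *: M g)
          ((a - 'i * a') *: conjf (M f) + (b - 'i * b') *: conjf (M g)) -
  quartic ((a + 'i * a') *: f + (b + 'i * b') *: g)
          ((a - 'i * a') *: conjf f + (b - 'i * b') *: conjf g).
have E0 : forall a a' b b' : C, E a a' b b' = 0.
  apply: polyfun4_eq0 => [a' b b'|a b b'|a a' b'|a a' b|a a' b b'];
    rewrite /E; first [
    under eq_fun do rewrite !quartic_lin;
    repeat first [exact: polyfun_cst|exact: polyfun_id|apply: polyfunD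
      |apply: polyfunM|apply: polyfunX|apply: polyfun_sum => ?
      |under eq_fun do rewrite -mulN1r]|idtac].
  (* At natural parameters the second argument is the conjugate of the first, so [MU] applies. *)
  have conjE (s t : nat) : s%:R - 'i * t%:R = (s%:R + 'i * t%:R)^* :> C.
    by rewrite rmorphD rmorphM /= conjCi !conjC_nat mulNr.
  rewrite !conjE -!conjfZ -!(operatorZ Ml).
  have conjD f1 f2 : conjf f1 + conjf f2 = conjf (f1 + f2).
    by rewrite -[f1]scale1r conjf_lin conjfZ rmorph1 !scale1r.
  have MD f1 f2 : M f1 + M f2 = M (f1 + f2).
    by rewrite -[f1]scale1r Ml (operatorZ Ml) !scale1r.
  by rewrite !conjD !MD MU subrr.
(* These parameters give coefficients (1, 0) in the first argument and (0, 1) in the second, leaving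
   [f] paired with [conjf g], which is [h]. *)
have := E0 (2^-1) (- 'i / 2) (2^-1) ('i / 2).
have i2 : 'i * 'i = -1 :> C by rewrite -expr2 sqrCi.
have h2 : 2^-1 + 2^-1 = 1 :> C by field.
have e1 : 2^-1 + 'i * (- 'i / 2) = 1 :> C by rewrite mulrA mulrN i2 opprK mul1r.
have e2 : 2^-1 - 'i * (- 'i / 2) = 0 :> C by rewrite mulrA mulrN i2 opprK mul1r subrr.
have e3 : 2^-1 + 'i * ('i / 2) = 0 :> C by rewrite mulrA i2 mulN1r subrr.
have e4 : 2^-1 - 'i * ('i / 2) = 1 :> C by rewrite mulrA i2 mulN1r opprK.
rewrite /E e1 e2 e3 e4 !scale0r !scale1r !addr0 !add0r conjfK.
by move/eqP; rewrite subr_eq0 => /eqP.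
Qed.

Lemma iso_quartic M : IsoU3 M ->
  forall f h, quartic (M f) (conjf (M (conjf h))) = quartic f h.
Proof.
case=> -[Ml _] MU; apply: quartic_conj_indep => // f.
by apply/U3norm_eq.
Qed.

End Quartic.

(** * Linear involutions preserving F are multiples of Weyl operators *)

Section Stabilizer.
Variables (R : realType) (n : nat).
Local Notation C := R[i].
Local Notation V := 'rV['F_2]_n.
Local Notation VV := (V * V)%type.
Local Notation L2 := {ffun V -> C}.
Implicit Types (x y z a b : V) (u v w : VV) (f g h : L2) (A M N : L2 -> L2).

(** The four signs multiply to the sign of [dotF2 b (x + y + z + t)], which is 1, so every [b]
    contributes equally. *)
Lemma sum_Weyl_prod f x y z t : x + y + z + t = 0 ->
  \sum_v Weyl v f x * Weyl v f y * Weyl v f z * Weyl v f t =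
  #|{: V}|%:R * \sum_a f (x + a) * f (y + a) * f (z + a) * f (t + a).
Proof.
move=> xyzt.
transitivity (\sum_a \sum_b Weyl (a, b) f x * Weyl (a, b) f y *
  Weyl (a, b) f z * Weyl (a, b) f t).
  by rewrite pair_bigA; apply: eq_bigr => -[].
rewrite mulr_sumr; apply: eq_bigr => a _.
rewrite [RHS]mulr_natl -sumr_const; apply: eq_bigr => b _.
rewrite !WeylE /=.
transitivity (phase R (a, b) ^+ 4 * sgnF2 R (dotF2 b (x + y + z + t)) *
  (f (x + a) * f (y + a) * f (z + a) * f (t + a))).
  rewrite !dotDr !sgnD; ring.
by rewrite phase4 xyzt dot0r sgn0 !mul1r.
Qed.

Section Invariant.
Variable A : L2 -> L2.
Hypotheses (Al : linear A) (AK : involutive A).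
Hypothesis Aq : forall f h, quartic (A f) h = quartic f h.

(** Polarise [Aq] in [h] and evaluate at four point masses. *)
Lemma invariant_parallelogram f x y z t : x + y + z + t = 0 ->
  \sum_a A f (x + a) * A f (y + a) * A f (z + a) * A f (t + a) =
  \sum_a f (x + a) * f (y + a) * f (z + a) * f (t + a).
Proof.
move=> xyzt; apply: (mulfI (card_neq0 R n)); rewrite -!sum_Weyl_prod //.
have pol := polarization4 (fun v => bilBr (Weyl v (A f)))
  (fun v => bilBr (Weyl v f)) (Aq f) (delta R x) (delta R y) (delta R z) (delta R t).
move: pol; under eq_bigr do rewrite !bil_delta; move=> ->.
by apply: eq_bigr => v _; rewrite !bil_delta.
Qed.

(** At the degenerate parallelogram 0, 0, 0, 0 both sides are sums of fourth powers, which polarise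
    in [f]. *)
Lemma invariant_fermat f g h k :
  \sum_x A f x * A g x * A h x * A k x = \sum_x f x * g x * h x * k x.
Proof.
have ev (B : L2 -> L2) : linear B -> forall x, {morph (fun f => B f x) : f g / f - g}.
  by move=> Bl x f1 f2; rewrite (operatorB Bl) !ffunE.
apply: (polarization4 (ev A Al) (ev id _)) => // f'.
have := @invariant_parallelogram f' 0 0 0 0; rewrite !addr0 => /(_ erefl) E.
by apply: etrans (etrans _ E) _; apply: eq_bigr => x _; rewrite add0r; ring.
Qed.

(** In [invariant_fermat], take third and fourth arguments that the involution sends to the point
    mass at [z]; the right side contains the product of two disjoint point masses. *)
Lemma column_disjoint x y z :
  x != y -> A (delta R x) z * A (delta R y) z = 0.
Proof.
move=> xy; have := invariant_fermat (delta R x) (delta R y) (A (delta R z)) (A (delta R z)).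
rewrite AK [RHS]big1 => [|t _]; last first.
  rewrite !deltaE; have [->|] := eqVneq t x; last by rewrite !mul0r.
  by rewrite (negbTE xy) mulr0 !mul0r.
rewrite (bigD1 z) //= big1 => [|t /negbTE tz]; last by rewrite !deltaE tz !mulr0.
by rewrite !deltaE eqxx !mulr1 addr0.
Qed.

(** Row [z] of the matrix of [A] has a nonzero entry by invertibility, and only one by
    [column_disjoint]. *)
Lemma invariant_monomial : exists (d : V -> C) (p : V -> V),
  (forall z, d z != 0) /\ (forall f z, A f z = d z * f (p z)).
Proof.
have /choice[p pP] z : exists x, A (delta R x) z != 0.
  apply: contrapT => nex.
  have : A (A (delta R z)) z = 0.
    rewrite operatorE // big1 // => x _.
    have [->|nz] := eqVneq (A (delta R x) z) 0; first by rewrite mulr0.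
    by case: nex; exists x.
  by rewrite AK deltaE eqxx => /eqP; rewrite oner_eq0.
exists (fun z => A (delta R (p z)) z), p; split=> // f z.
rewrite operatorE // (bigD1 (p z)) //= big1 ?addr0 1?mulrC // => x xp.
have /eqP := column_disjoint z xp.
by rewrite mulf_eq0 (negbTE (pP z)) orbF => /eqP ->; rewrite mulr0.
Qed.

Lemma invariant_translation : exists (d : V -> C) a,
  (forall z, d z != 0) /\ (forall f z, A f z = d z * f (z + a)).
Proof.
have [d [p [d0 AE]]] := invariant_monomial.
have pK z : p (p z) = z.
  have := congr1 (fun g => g z) (AK (delta R z)).
  rewrite /= !AE !deltaE eqxx; case: eqP => // _.
  by rewrite !mulr0 => /esym/eqP; rewrite oner_eq0.
have pD z k : p (z + k) = p z + k.
  have [->|k0] := eqVneq k 0; first by rewrite !addr0.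
  apply/eqP; apply: contraT => npk.
  have pinj : injective p by apply: can_inj pK.
  (* Test the parallelogram 0, 0, k, k on these two points. If they do not differ by [k], the right
     side is 0, while the left side is a positive multiple of the nonzero [c] below. *)
  pose f : L2 := [ffun x => ((x == p z) || (x == p (z + k)))%:R].
  have := @invariant_parallelogram f 0 0 k k.
  rewrite !add0r addVV => /(_ erefl).
  rewrite [RHS]big1 => [|a _]; last first.
    rewrite add0r !ffunE.
    have [ea|na] /= := eqVneq a (p z).
      have -> : (k + a == p z) = false.
        by apply/negbTE; rewrite ea -subr_eq0 addrK.
      have -> : (k + a == p (z + k)) = false.
        by apply/negbTE; rewrite ea eq_sym (addrC k).
      by rewrite /= !mulr0.
    have [ea|na'] /= := eqVneq a (p (z + k)); last by rewrite !mul0r.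
    have -> : (k + a == p z) = false.
      apply/negbTE; rewrite ea; apply: contra npk => /eqP <-.
      by rewrite (addrC k) addVK.
    have -> : (k + a == p (z + k)) = false.
      by apply/negbTE; rewrite ea -subr_eq0 addrK.
    by rewrite /= !mulr0.
  pose c := (d z * d (z + k)) ^+ 2.
  rewrite (eq_bigr (fun a => c * ((a == z) || (a == z + k))%:R)) => [|a _].
    rewrite -mulr_sumr => /eqP; rewrite mulf_eq0 expf_eq0 /= mulf_eq0 !(negbTE (d0 _)) /=.
    rewrite -natr_sum pnatr_eq0 sum_nat_eq0 => /forallP/(_ z).
    by rewrite eqxx.
  rewrite add0r !AE !ffunE !(inj_eq pinj) (addrC k).
  have [->|az] /= := eqVneq a z; first by rewrite eqxx orbT /c /=; ring.
  have [->|az'] /= := eqVneq a (z + k); last by rewrite /= !(mulr0, mul0r).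
  by rewrite addVK eqxx /c /=; ring.
exists d, (p 0); split=> // f z.
by rewrite AE -[in p z](add0r z) pD addrC.
Qed.

(** Apply the parallelogram identity to a translated indicator of the subgroup [H]. Each point of
    [H] contributes the same product [D 0], so [D 0 - 1] times the size of [H] vanishes, even when
    the points listed in [H] coincide. *)
Lemma parallelogram_phase (d : V -> C) a :
  (forall f z, A f z = d z * f (z + a)) ->
  forall x y, d 0 * d x * d y * d (x + y) = 1.
Proof.
move=> AE x y.
pose H := [pred t : V | [|| t == 0, t == x, t == y | t == x + y]].
pose D t := d t * d (x + t) * d (y + t) * d (x + y + t).
pose f : L2 := [ffun t => ((t + a) \in H)%:R].
have HD t : t \in H -> [/\ x + t \in H, y + t \in H, x + y + t \in H & D t = D 0].
  rewrite !inE /D => /or4P[] /eqP->; rewrite ?addr0 ?add0r ?addVV ?eqxx ?orbT.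
  - by split.
  - rewrite (addrC y x) eqxx !orbT (_ : x + y + x = y); last by char2.
    by rewrite eqxx !orbT; split=> //; ring.
  - rewrite addVK eqxx !orbT; split=> //; ring.
  - rewrite (_ : x + (x + y) = y); last by char2.
    rewrite (_ : y + (x + y) = x); last by char2.
    by rewrite !eqxx !orbT; split=> //; ring.
have HC t : t \notin H -> f (t + a) = 0 by rewrite ffunE addVK => /negbTE ->.
have xy0 : 0 + x + y + (x + y) = 0 by char2.
have /eqP := invariant_parallelogram f xy0.
rewrite -[X in _ == X](sum_shift a) -subr_eq0 -sumrB.
under eq_bigr do rewrite !AE !add0r !addrA.
rewrite (eq_bigr (fun t => (D 0 - 1) * (t \in H)%:R)) => [|t _]; last first.
  have [tH|tH] := boolP (t \in H); last by rewrite HC // !(mulr0, mul0r) subrr.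
  have [t1 t2 t3 <-] := HD _ tH.
  rewrite !ffunE !addVK tH t1 t2 t3 /D /=; ring.
rewrite -mulr_sumr mulf_eq0 subr_eq0.
have -> : D 0 = d 0 * d x * d y * d (x + y) by rewrite /D !addr0.
case/orP => [/eqP->//|].
rewrite -natr_sum pnatr_eq0 sum_nat_eq0 => /forallP/(_ 0).
by rewrite inE eqxx.
Qed.

(** The relation at (0, 0) and (0, x) makes [d x / d 0] a sign; at (x, y) it makes this sign
    multiplicative, hence a character. *)
Lemma invariant_Weyl : exists (c : C) v, forall f, A f = c *: Weyl v f.
Proof.
have [d [a [d0 AE]]] := invariant_translation.
have par := parallelogram_phase AE.
have d4 : d 0 ^+ 4 = 1 by rewrite -[RHS](par 0 0) addr0; ring.
have d2 x : d x ^+ 2 = d 0 ^+ 2.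
  rewrite -[RHS]mulr1 -(par 0 x) add0r.
  transitivity (d 0 ^+ 4 * d x ^+ 2); [by rewrite d4 mul1r|ring].
have [|x y|b bE] := @character_sgn R n (fun x => d x / d 0).
- by move=> x; rewrite exprMn d2 exprVn mulfV // expf_neq0.
- apply: (mulfI (mulf_neq0 (d0 0) (d0 0))).
  transitivity (d 0 * d (x + y)); first by field.
  transitivity (d x * d y); last by field.
  apply: (mulIf (mulf_neq0 (d0 x) (d0 y))).
  transitivity (1 : C); first by rewrite -(par x y); ring.
  transitivity (d x ^+ 2 * d y ^+ 2); last by ring.
  by rewrite !d2 -d4; ring.
exists (d 0 / phase R (a, b)), (a, b) => f; apply/ffunP => x.
rewrite ffun_scaleE WeylE AE /= -bE; field.
by rewrite d0 phase_neq0.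
Qed.

End Invariant.
End Stabilizer.

(** * Operators permuting the Weyl operators up to scalars *)

Section Clifford.
Variables (R : realType) (n : nat).
Local Notation C := R[i].
Local Notation V := 'rV['F_2]_n.
Local Notation VV := (V * V)%type.
Local Notation L2 := {ffun V -> C}.
Implicit Types (x y z a b : V) (u v w : VV) (f g h : L2) (A M N : L2 -> L2).

Lemma delta_neq0 y : (delta R y : L2) != 0.
Proof.
apply/eqP => /ffunP/(_ y); rewrite deltaE eqxx ffunE => /eqP.
by rewrite oner_eq0.
Qed.

Lemma WeylZ v (c : C) f : Weyl v (c *: f) = c *: Weyl v f.
Proof. exact: operatorZ (@Weyl_linear R n v) c f. Qed.

(** The point mass at 0 detects the translation, the constant function 1 the character. *)
Lemma Weyl_scalar_inj (c d : C) u v : c != 0 ->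
  (forall f, c *: Weyl u f = d *: Weyl v f) -> u = v.
Proof.
case: u v => [u1 u2] [v1 v2] c0 E.
have e1 : u1 = v1.
  have /ffunP/(_ u1) := E (delta R 0).
  rewrite !(WeylE, ffun_scaleE) !deltaE /= addVV eqxx mulr1 => /eqP.
  have [/eqP|_] := eqVneq (u1 + v1) 0; first by rewrite addr_eq0 oppV => /eqP.
  rewrite !mulr0 !mulf_eq0 (negbTE c0) (negbTE (phase_neq0 _ _)).
  by rewrite (negbTE (sgn_neq0 _ _)).
rewrite -{}e1 in E *.
pose one : L2 := [ffun=> 1].
have E1 x : c * phase R (u1, u2) * sgnF2 R (dotF2 u2 x) =
            d * phase R (u1, v2) * sgnF2 R (dotF2 v2 x).
  have /ffunP/(_ x) := E one.
  by rewrite !(WeylE, ffun_scaleE) !ffunE /= !mulr1 !mulrA.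
have E0 : c * phase R (u1, u2) = d * phase R (u1, v2).
  by have := E1 0; rewrite !dot0r !sgn0 !mulr1.
congr (_, _); apply/rowP => j; rewrite -!dot_unit; apply: (@sgn_inj R).
by apply: (mulfI (mulf_neq0 c0 (phase_neq0 R (u1, u2)))); rewrite E1 E0.
Qed.

Lemma Weyl_eq0 v f : (Weyl v f == 0) = (f == 0).
Proof.
apply/eqP/eqP => [W0|->]; last exact: operator0 (@Weyl_linear R n v).
by rewrite -(WeylK v f) W0 (operator0 (@Weyl_linear R n v)).
Qed.

(** Conjugation by [M] sends W(v) to a multiple of W(u), stated without an inverse of [M]. *)
Definition intertwines M v u :=
  exists c : C, forall f, M (Weyl v f) = c *: Weyl u (M f).

Lemma intertwines_comp M N v u w :
  linear M -> intertwines N v u -> intertwines M u w -> intertwines (M \o N) v w.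
Proof.
move=> Ml [c cP] [d dP]; exists (c * d) => f /=.
by rewrite cP (operatorZ Ml) dP scalerA.
Qed.

Section Invertible.
Variables M M' : L2 -> L2.
Hypotheses (Ml : linear M) (MK : cancel M M') (M'K : cancel M' M).

(** Both Weyl operators are involutions, so using the relation twice produces [c ^+ 2]. *)
Lemma intertwiner_sqr (c : C) v u :
  (forall f, M (Weyl v f) = c *: Weyl u (M f)) -> c ^+ 2 = 1.
Proof.
move=> cP; have := cP (Weyl v (M' (delta R 0))).
rewrite WeylK cP WeylZ WeylK M'K scalerA => /eqP.
rewrite -[X in X == _]scale1r eq_sym -subr_eq0 -scalerBl scaler_eq0.
by rewrite (negbTE (delta_neq0 0)) orbF subr_eq0 => /eqP.
Qed.

Lemma intertwiner_neq0 (c : C) v u :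
  (forall f, M (Weyl v f) = c *: Weyl u (M f)) -> c != 0.
Proof.
by move/intertwiner_sqr => c2; rewrite -sqrf_eq0 c2 oner_eq0.
Qed.

Lemma intertwines_uniq v u w : intertwines M v u -> intertwines M v w -> u = w.
Proof.
move=> [c cP] [d dP]; apply: (@Weyl_scalar_inj c d); first exact: intertwiner_neq0 cP.
by move=> f; rewrite -(M'K f) -cP -dP.
Qed.

Lemma intertwines_inj v w u : intertwines M v u -> intertwines M w u -> v = w.
Proof.
move=> [c cP] [d dP]; apply: (@Weyl_scalar_inj d c); first exact: intertwiner_neq0 dP.
move=> f; apply: (can_inj MK).
by rewrite !(operatorZ Ml) cP dP !scalerA mulrC.
Qed.

Lemma intertwinesD v w u u' :
  intertwines M v u -> intertwines M w u' -> intertwines M (v + w) (u + u').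
Proof.
move=> [c cP] [d dP]; exists ((cocycle R v w)^-1 * (c * d * cocycle R u u')) => f.
rewrite -[Weyl (v + w) f](scalerK (cocycle_neq0 R v w)) -Weyl_mul (operatorZ Ml).
by rewrite cP dP WeylZ Weyl_mul !scalerA !mulrA.
Qed.

(** Conjugation preserves the commutation sign, which determines the symplectic form. *)
Lemma intertwines_sympl v w u u' :
  intertwines M v u -> intertwines M w u' -> sympl u u' = sympl v w.
Proof.
move=> [c cP] [d dP]; apply: (@sgn_inj R).
pose f := M' (delta R 0).
have E : M (Weyl v (Weyl w f)) = M (sgnF2 R (sympl v w) *: Weyl w (Weyl v f)).
  by rewrite Weyl_comm.
move: E; rewrite (operatorZ Ml) !(cP, dP) !WeylZ M'K.
rewrite (Weyl_comm u u') !scalerA => /eqP.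
rewrite -subr_eq0 -scalerBl scaler_eq0 !Weyl_eq0 (negbTE (delta_neq0 0)) orbF.
have c0 := intertwiner_neq0 cP; have d0 := intertwiner_neq0 dP.
rewrite (_ : _ - _ = c * d * (sgnF2 R (sympl u u') - sgnF2 R (sympl v w))); last by ring.
by rewrite !mulf_eq0 (negbTE c0) (negbTE d0) /= subr_eq0 => /eqP.
Qed.

(** Uniqueness of the index makes [S] additive, hence linear over the two-element field; injectivity
    on a finite set gives bijectivity. *)
Lemma intertwines_Sp S : (forall v, intertwines M v (S v)) -> Sp S.
Proof.
move=> MS.
have SD v w : S (v + w) = S v + S w.
  exact: intertwines_uniq (MS _) (intertwinesD (MS _) (MS _)).
have S0 : S 0 = 0 by apply: (@addrI _ (S 0)); rewrite -SD !addr0.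
split; last split.
- move=> k v w; rewrite -(_ : k *: v + w = (k *: v.1 + w.1, k *: v.2 + w.2)) //.
  rewrite SD; case: (F2_cases k) => ->; last by rewrite !scale1r; case: (S v) (S w) => [? ?] [].
  by rewrite !scale0r S0 !add0r; case: (S w).
- by apply: injF_bij => v w E; apply: intertwines_inj (MS v) _; rewrite E.
- by move=> v w; apply: intertwines_sympl.
Qed.

End Invertible.

(** Reindexing by [S] matches the terms of F; the scalars have square 1 and vanish in fourth
    powers. *)
Lemma intertwining_iso M S : unitary M -> bijective S ->
  (forall v, intertwines M v (S v)) -> IsoU3 M.
Proof.
move=> uM Sb MS; split=> // f; apply/U3norm_eq.
have [Ml [MK M'K]] := uM.
rewrite /quartic (reindex S) /=; last exact: onW_bij.
apply: eq_bigr => v _; have [c cP] := MS v.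
have c2 := intertwiner_sqr M'K cP.
rewrite -[in RHS](unitary_bil _ _ uM) cP bilZl exprMn (exprM c 2 2) c2 expr1n.
by rewrite mul1r.
Qed.

Lemma iso_intertwines M : IsoU3 M -> forall v, exists u, intertwines M v u.
Proof.
move=> isoM v; have [[Ml [MK M'K]] _] := isoM.
have Mq := iso_quartic isoM.
have M'l : linear (adjoint M) by case: (unitary_adjoint isoM.1).
pose A := M \o (@Weyl R n v \o adjoint M).
have Al : linear A by apply: linear_comp => //; apply: linear_comp => //; apply: Weyl_linear.
have AK : involutive A by move=> f; rewrite /A /= MK WeylK M'K.
have Aq f h : quartic (A f) h = quartic f h.
  (* Write [h] as [conjf (M (conjf k))], so that [Mq] strips [M], Weyl invariance removes W(v), and
     [Mq] restores [M]. *)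
  rewrite -[h](conjfK) -(M'K (conjf h)) -[adjoint M _](conjfK).
  by rewrite /A /= Mq quartic_Weyl -Mq M'K.
have [c [u cu]] := invariant_Weyl Al AK Aq.
by exists u, c => f; rewrite -cu /A /= MK.
Qed.

(* N delta_0 is a joint eigenvector of the W(0, b), hence a multiple of some
   delta_a; the W(x, 0) then determine N up to a character. *)
Lemma centralizer_Weyl N : unitary N -> (forall v, intertwines N v v) ->
  exists (c : C) v, `|c| = 1 /\ N = (fun f => c *: Weyl v f).
Proof.
move=> uN Nv; have [Nl [NK N'K]] := uN.
have W0b b f x : Weyl (0, b) f x = sgnF2 R (dotF2 b x) * f x.
  have ph : phase R (0, b) = 1.
    rewrite /phase /absV big1 // => j _.
    by rewrite /= !mxE mul0r.
  by rewrite WeylE ph mul1r addr0.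
have Wx0 y f x : Weyl (y, 0) f x = f (x + y).
  have ph : phase R (y, 0) = 1.
    rewrite /phase /absV big1 // => j _.
    by rewrite /= !mxE mulr0.
  by rewrite WeylE ph /= dotC dot0r sgn0 !mul1r.
pose g := N (delta R 0).
have [a ga] : exists a, g a != 0.
  apply: contrapT => nex; have /negP := delta_neq0 0; apply.
  rewrite -(NK (delta R 0)) -/g (_ : g = 0); last first.
    apply/ffunP => x; rewrite [RHS]ffunE; apply/eqP; apply: contraT => gx.
    by case: nex; exists x.
  by rewrite (operator0 (unitary_adjoint uN).1).
have gE x : g x = g a * (x == a)%:R.
  have [->|xa] := eqVneq x a; first by rewrite mulr1.
  rewrite mulr0; apply/eqP; apply: contraT => gx; case/negP: xa.
  apply/eqP/rowP => j; rewrite -!(dot_unit _ j) !(dotC _ (delta_mx _ _)).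
  (* W(0, b) fixes the point mass at 0, so the sign of coordinate [j] is the same throughout the
     support of [g]. *)
  pose b : V := delta_mx ord0 j; rewrite -/b; apply: (@sgn_inj R).
  have [c cP] := Nv (0, b).
  have c0 := intertwiner_neq0 N'K cP.
  have Wd : Weyl (0, b) (delta R 0) = delta R 0.
    apply/ffunP => y; rewrite W0b !deltaE.
    by have [->|_] := eqVneq y 0; rewrite ?mulr0 // dot0r sgn0 mulr1.
  have Eg y : g y != 0 -> c * sgnF2 R (dotF2 b y) = 1.
    move=> gy; have /ffunP/(_ y) := cP (delta R 0).
    rewrite Wd -/g ffun_scaleE W0b => E; apply: (mulIf gy).
    by rewrite mul1r [RHS]E mulrA.
  by apply: (mulfI c0); rewrite !Eg.
have /choice[s sP] (x : V) : exists c : C, forall f, N (Weyl (x, 0) f) = c *: Weyl (x, 0) (N f).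
  by case: (Nv (x, 0)) => c; exists c.
have deltaW y : delta R y = Weyl (y, 0) (delta R 0).
  by apply/ffunP => x; rewrite Wx0 !deltaE addr_eq0 oppV.
have s2 x : s x ^+ 2 = 1 by exact: (intertwiner_sqr N'K (sP x)).
have sM x y : s (x + y) = s x * s y.
  have Wxy f : Weyl (x + y, 0) f = Weyl (x, 0) (Weyl (y, 0) f).
    by apply/ffunP => z; rewrite !Wx0 addrA.
  have := sP (x + y) (adjoint N (delta R 0)).
  rewrite !Wxy !sP WeylZ N'K scalerA => /eqP.
  rewrite -subr_eq0 -scalerBl scaler_eq0 -Wxy Weyl_eq0 (negbTE (delta_neq0 0)) orbF.
  by rewrite subr_eq0 => /eqP.
have [b sb] := character_sgn s2 sM.
have NE f x : N f x = g a * s (x + a) * f (x + a).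
  rewrite operatorE // (bigD1 (x + a)) //= big1 ?addr0 => [|y yxa].
    rewrite deltaW sP ffun_scaleE Wx0 -/g gE (_ : x + (x + a) = a); last by char2.
    rewrite eqxx /=; ring.
  rewrite deltaW sP ffun_scaleE Wx0 -/g gE (_ : _ == a = false) ?mulr0 //.
  apply: contraNF yxa => /eqP <-; rewrite (_ : x + (x + y) = y) //; by char2.
pose c := g a * s a / phase R (a, b).
have NW : N = (fun f => c *: Weyl (a, b) f).
  apply: funext => f; apply/ffunP => x.
  rewrite NE sM ffun_scaleE WeylE /= -sb /c; field.
  exact: phase_neq0.
exists c, (a, b); split=> //.
(* Comparing the norms of the point mass at [a] and its image, a multiple of the point mass at 0,
   gives modulus 1. *)
have := unitary_bil (delta R a) (delta R a) uN.
have -> : N (delta R a) = (c * phase R (a, b)) *: delta R 0.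
  rewrite NW -scalerA; congr (_ *: _); apply/ffunP => x.
  rewrite WeylE ffun_scaleE !deltaE -subr_eq0 addrK.
  by have [->|_] := eqVneq x 0; rewrite ?mulr0 // dot0r sgn0 !mulr1.
rewrite conjfZ bilZl bilC bilZl bilC !conj_delta !bil_delta !deltaE !eqxx mulr1.
move=> E; have : `|c * phase R (a, b)| ^+ 2 = 1 by rewrite normCK.
rewrite normrM norm_phase mulr1 => /eqP; rewrite sqrf_eq1 => /orP[/eqP//|].
by move/eqP => cN; have := normr_ge0 c; rewrite cN oppr_ge0 ler10.
Qed.

Lemma intertwines_Weyl (c : C) v w : intertwines (fun f => c *: Weyl v f) w w.
Proof.
exists (sgnF2 R (sympl v w)) => f.
by rewrite Weyl_comm WeylZ !scalerA mulrC.
Qed.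

Lemma HW_scalar_Weyl M : HW M ->
  exists (c : C) v, `|c| = 1 /\ M = (fun f => c *: Weyl v f).
Proof.
elim=> {M} [v||M N _ [c [v [c1 ->]]] _ [d [w [d1 ->]]]|M N _ [c [v [c1 ->]]] MN NM].
- by exists 1, v; rewrite normr1; split=> //; apply: funext => f; rewrite scale1r.
- exists 1, 0; rewrite normr1; split=> //; apply: funext => f.
  rewrite scale1r; apply/ffunP => x; rewrite WeylE /= addr0.
  rewrite dotC dot0r sgn0 /phase /absV big1 ?mul1r // => j _.
  by rewrite !mxE mul0r.
- exists (c * d * cocycle R v w), (v + w).
  rewrite 2!normrM c1 d1 norm_cocycle !mulr1; split=> //; apply: funext => f /=.
  by rewrite WeylZ Weyl_mul !scalerA mulrA.
- have c0 : c != 0 by rewrite -normr_eq0 c1 oner_eq0.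
  exists c^-1, v; rewrite normfV c1 invr1; split=> //; apply: funext => f.
  rewrite -[in RHS](MN f) WeylZ WeylK scalerA mulVf //.
  by rewrite scale1r.
Qed.

Lemma U1HW_P M : U1HW M <->
  exists (c : C) v, `|c| = 1 /\ M = (fun f => c *: Weyl v f).
Proof.
split=> [[a [W [a1 [/HW_scalar_Weyl[c [v [c1 ->]]] ->]]]]|[c [v [c1 ->]]]].
  exists (a * c), v; rewrite normrM a1 c1 mulr1; split=> //.
  by apply: funext => f; rewrite scalerA.
by exists c, (Weyl v); split=> //; split=> //; apply: HW_Weyl.
Qed.

(** The default [v] is never reached for isometries, by [iso_intertwines]. *)
Definition symplectic_part M v : VV :=
  if pselect (exists u, intertwines M v u) is left e then sval (cid e) else v.

Lemma symplectic_partP M : IsoU3 M ->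
  forall v, intertwines M v (symplectic_part M v).
Proof.
move=> isoM v; rewrite /symplectic_part; case: pselect => [e|]; first by case: cid.
by move=> /(_ (iso_intertwines isoM v)).
Qed.

Lemma symplectic_part_Sp M : IsoU3 M -> Sp (symplectic_part M).
Proof.
move=> isoM; have [[Ml [MK M'K]] _] := isoM.
exact: (intertwines_Sp Ml MK M'K (symplectic_partP isoM)).
Qed.

Lemma symplectic_part_eq M S : IsoU3 M -> (forall v, intertwines M v (S v)) ->
  symplectic_part M = S.
Proof.
move=> isoM MS; apply: funext => v; have [[_ [_ M'K]] _] := isoM.
exact: (intertwines_uniq M'K (symplectic_partP isoM v) (MS v)).
Qed.

Lemma iso_Weyl (c : C) v : `|c| = 1 -> IsoU3 (fun f => c *: Weyl v f).
Proof.
move=> c1; apply: (@intertwining_iso _ id); first exact: unitary_Weyl.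
  by exists id.
exact: intertwines_Weyl.
Qed.

Lemma iso_comp M N : IsoU3 M -> IsoU3 N -> IsoU3 (M \o N).
Proof.
move=> [uM Mn] [uN Nn]; split; first exact: unitary_comp.
by move=> f; rewrite Mn Nn.
Qed.

End Clifford.

(** * The isometry group and its symplectic quotient *)

Theorem theorem2p12 (R : realType) (n : nat)
  (sigma : (V2n n -> V2n n) -> (L2 R n -> L2 R n))
  (Hsigma : forall S, Sp S ->
     unitary (sigma S) /\
     forall x : V2n n, exists c : Cx R,
       forall f, sigma S (Weyl x (adjoint (sigma S) f)) = c *: Weyl (S x) f) :
  (forall M : L2 R n -> L2 R n, unitary M ->
     (IsoU3 M <->
      exists (alpha : Cx R) (S : V2n n -> V2n n) (v : V2n n),
        `|alpha| = 1 /\ Sp S /\ M = (fun f => alpha *: sigma S (Weyl v f))))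
  /\
  (* Iso_{U^3} / (U(1).HW) ~= Sp, via the first isomorphism theorem *)
  (exists phi : (L2 R n -> L2 R n) -> (V2n n -> V2n n),
     (forall M : L2 R n -> L2 R n, IsoU3 M -> Sp (phi M)) /\
     (forall M N : L2 R n -> L2 R n, IsoU3 M -> IsoU3 N -> phi (M \o N) = phi M \o phi N) /\
     (forall S, Sp S -> exists M : L2 R n -> L2 R n, IsoU3 M /\ phi M = S) /\
     (forall M : L2 R n -> L2 R n, U1HW M -> IsoU3 M) /\
     (forall M : L2 R n -> L2 R n, IsoU3 M -> (phi M = id <-> U1HW M))).
Proof.
have sigmaP S : Sp S -> forall v, intertwines (sigma S) v (S v).
  move=> SpS v; have [[_ [sK _]] /(_ v)[c cP]] := Hsigma S SpS.
  by exists c => f; rewrite -cP sK.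
have sigma_iso S : Sp S -> IsoU3 (sigma S).
  move=> SpS; apply: (@intertwining_iso _ _ _ S); first by case: (Hsigma S SpS).
    by case: SpS => _ [].
  exact: sigmaP.
split=> [M uM|]; first split.
- move=> isoM; pose S := symplectic_part M.
  have SpS : Sp S := symplectic_part_Sp isoM.
  have [us _] := Hsigma S SpS; have [sl [sK s'K]] := us.
  (* [M] and [sigma S] act alike on Weyl indices, so [N] fixes every index and is a scalar times a
     Weyl operator. *)
  pose N := adjoint (sigma S) \o M.
  have uN : unitary N by apply: unitary_comp => //; apply: unitary_adjoint.
  have [v|c [v [c1 NE]]] := centralizer_Weyl uN.
    have [c cP] := symplectic_partP isoM v; have [d dP] := sigmaP S SpS v.
    have d0 := intertwiner_neq0 s'K dP.
    exists (d^-1 * c) => f; rewrite /N /= cP; apply: (can_inj sK).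
    rewrite (operatorZ sl) dP !s'K -/S !scalerA; congr (_ *: _); field.
    exact: d0.
  exists c, S, v; split=> //; split=> //; apply: funext => f.
  by rewrite -(operatorZ sl) -[c *: Weyl v f]/((fun f => c *: Weyl v f) f) -NE /N /= s'K.
- case=> c [S [v [c1 [SpS ->]]]].
  have sl : linear (sigma S) by case: (sigma_iso S SpS) => -[].
  rewrite (_ : (fun f => _) = sigma S \o (fun f => c *: Weyl v f)).
    by apply: iso_comp; [apply: sigma_iso|apply: iso_Weyl].
  by apply: funext => f /=; rewrite (operatorZ sl).
(* Surjectivity comes from [sigma], and the kernel from [centralizer_Weyl]. *)
exists (@symplectic_part R n).
split; first exact: symplectic_part_Sp; split; last split; last split.
- move=> M N isoM isoN; apply: symplectic_part_eq; first exact: iso_comp.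
  move=> v; apply: intertwines_comp (symplectic_partP isoN v) (symplectic_partP isoM _).
  by case: isoM => -[].
- move=> S SpS; exists (sigma S); split; first exact: sigma_iso.
  by apply: symplectic_part_eq; [apply: sigma_iso|apply: sigmaP].
- by move=> M /U1HW_P[c [v [c1 ->]]]; apply: iso_Weyl.
- move=> M isoM; split=> [Mid|/U1HW_P[c [v [c1 ME]]]].
    apply/U1HW_P/centralizer_Weyl => [|v]; first by case: isoM.
    by have := symplectic_partP isoM v; rewrite Mid.
  by apply: symplectic_part_eq => // v'; rewrite ME; apply: intertwines_Weyl.
Qed.
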